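(* The Kauffman bracket polynomials of Conway-Coxeter friezes of zigzag-type satisfy $$\langle\Gamma(\emptyset)\rangle=-A^4-A^{-4},\qquad \langle\Gamma(L)\rangle=-A^4+1+A^{-8},\qquad \langle\Gamma(R)\rangle=A^8+1-A^{-4},$$ and for $LR$ words $w,w'$ whose corresponding rational numbers are Farey neighbors (the one of $w$ being the smaller), $$\langle\Gamma(w\vee w')\rangle=-A^4\langle\Gamma(w)\rangle-A^{-4}\langle\Gamma(w')\rangle .$$ In particular, for every positive integer $k$ and every $LR$ word $w$, $$\langle\Gamma(R^kLw)\rangle=-A^4\langle\Gamma(R^{k-1}Lw)\rangle-A^{-4}\langle\Gamma(w)\rangle ,$$ $$\langle\Gamma(L^kRw)\rangle=-A^4\langle\Gamma(w)\rangle-A^{-4}\langle\Gamma(L^{k-1}Rw)\rangle .$$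
   Context: $LR$ words. An $LR$ word is a finite word in the letters $L,R$ (possibly empty, $\emptyset$); $\ell(w)$ is its length. Consider the part of the Stern-Brocot tree below $\frac12$: the root $\frac12$ has parents $(\frac01,\frac11)$, and a vertex $\alpha$ with parents $(y,z)$ has left child $y\sharp\alpha$ (with parents $(y,\alpha)$) and right child $\alpha\sharp z$ (with parents $(\alpha,z)$). Every $\alpha\in\mathbb{Q}\cap(0,1)$ occurs exactly once; record the downward path from $\frac12$ to $\alpha$ as a sequence of letters $L$ (left step) and $R$ (right step), and let $w(\alpha)$ be this sequence written in reverse order (last step first). The map $\alpha\mapsto w(\alpha)$ is a bijection from $\mathbb{Q}\cap(0,1)$ to $LR$ words; the inverse image of $w$ is the rational number corresponding to $w$. If $w,w'$ correspond to Farey neighbors $\frac pq<\frac rs$ in $(0,1)$, then $w\vee w':=Lw'$ if $\ell(w)<\ell(w')$ and $w\vee w':=Rw$ if $\ell(w)>\ell(w')$. Friezes. $\Gamma(w)$ denotes the Conway-Coxeter frieze of zigzag-type determined by the $LR$ word $w$ (having a zigzag line of 1's of shape $w$ joining the top row of 1's to the bottom row of 1's). Its Kauffman bracket polynomial, computed with the word $w$, is $\langle\Gamma(w)\rangle:=v(\phi(\alpha))\in\mathbb{Z}[A,A^{-1}]$, where $\alpha\in\mathbb{Q}\cap(0,1)$ is the rational number with $w(\alpha)=w$. Notation. $\Lambda=\mathbb{Z}[A,A^{-1}]$, $\delta=-A^2-A^{-2}$, and $\Lambda^2=\Lambda[\infty]\oplus\Lambda[0]$ is the free $\Lambda$-module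 with basis $[\infty],[0]$. The map $v:\Lambda^2\to\Lambda$ is $v(a[\infty]+b[0])=a\delta+b$. Farey sums. Irreducible fractions have non-negative denominator, with $0=\frac01$, $\infty=\frac10$. Fractions $\frac pq,\frac rs$ (listed in ascending order) are Farey neighbors if $qr-ps=1$; their Farey sum is $\frac pq\sharp\frac rs=\frac{p+r}{q+s}$. Each positive rational $\alpha$ is $y\sharp z$ for a unique pair $(y,z)$ of Farey neighbors, called the pair of parents of $\alpha$. Ancestor triangle. Let $\alpha$ be a positive rational. Put $(y_1,z_1)=(\frac01,\frac10)$ and $m_i=y_i\sharp z_i$. If $m_i=\alpha$ stop and put $N=i$; otherwise $(y_{i+1},z_{i+1})=(m_i,z_i)$ if $\alpha>m_i$ and $(y_i,m_i)$ if $\alpha<m_i$. The ancestor triangle of $\alpha$ is the planar triangle with upper left corner $\frac01$, upper right corner $\frac10$ and bottom corner $\alpha$, decomposed into the $N$ fundamental triangles with vertices $y_i$ (upper left), $z_i$ (upper right), $m_i$ (bottom), $i=1,\ldots,N$, the $(i+1)$-st glued below the $i$-th along the edge $y_{i+1}z_{i+1}$. Its left oblique side is the chain of edges through the distinct $y_i$'s from $\frac01$ down to $\alpha$, and its right oblique side is the chain of edges through the distinct $z_i$'s from $\frac10$ down to $\alpha$; $l(\alpha)$, $r(\alpha)$ are the numbers of edges on the left and right oblique sides. For $\ast\in\{0,\infty\}$, $P_\ast(\alpha)$ is the set of descending paths from $\ast$ to $\alpha$, i.e. edge paths in the ancestor triangle in which each step goes from a vertex to a vertex of which it is a parent. Such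 a path $\gamma$ cuts the ancestor triangle into a left and a right part; $w_L(\gamma)$, $w_R(\gamma)$ are the numbers of fundamental triangles on the left and on the right of $\gamma$. The map $\phi$ from the non-negative rationals together with $\infty$ to $\Lambda^2$ is defined by $\phi(\infty)=A^6[\infty]$, $\phi(0)=[0]$ and, for rational $\alpha>0$, $$\phi(\alpha)=\Bigl(A^6(-A^4)^{-r(\alpha)}\sum_{\gamma\in P_\infty(\alpha)}(-A^4)^{w_R(\gamma)}\Bigr)[\infty]+\Bigl((-A^4)^{l(\alpha)}\sum_{\gamma\in P_0(\alpha)}(-A^4)^{-w_L(\gamma)}\Bigr)[0].$$ *)

(* Defs.v *)
From HB Require Import structures.
From mathcomp Require Import all_boot all_order all_algebra.
From mathcomp Require Import boolp.

Set Implicit Arguments.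
Unset Strict Implicit.
Unset Printing Implicit Defensive.

Import GRing.Theory.

Local Open Scope ring_scope.

(* Z[A, A^-1] is the subring of Q(A) = Frac Z[A] formed by the p / A^n. *)
Definition is_laurent : {pred {fraction {poly int}}} :=
  fun f => `[< exists (p : {poly int}) (n : nat),
                 f = tofrac p / tofrac 'X ^+ n >].

Lemma tofracX_neq0 : tofrac ('X : {poly int}) != 0.
Proof. by rewrite tofrac_eq0 polyX_eq0. Qed.

Lemma is_laurent_subring : subring_closed is_laurent.
Proof.
split.
- by apply/asboolP; exists 1, 0%N; rewrite expr0 divr1 tofrac1.
- move=> f g /asboolP[p [m ->]] /asboolP[q [n ->]]; apply/asboolP.
  exists (p * 'X^n - q * 'X^m), (m + n)%N.
  rewrite tofracB !tofracM !tofracXn exprD -!mulNr addf_div //;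
    exact/expf_neq0/tofracX_neq0.
- move=> f g /asboolP[p [m ->]] /asboolP[q [n ->]]; apply/asboolP.
  by exists (p * q), (m + n)%N; rewrite tofracM exprD mulf_div.
Qed.

HB.instance Definition _ :=
  GRing.isSubringClosed.Build {fraction {poly int}} is_laurent
    is_laurent_subring.

Record laurent : Type := Laurent {
  laurent_val :> {fraction {poly int}};
  laurentP : laurent_val \in is_laurent }.

HB.instance Definition _ := [isSub for laurent_val].
HB.instance Definition _ := [Choice of laurent by <:].
HB.instance Definition _ := [SubChoice_isSubComNzRing of laurent by <:].

Definition laurent_unit : {pred laurent} :=
  fun f => (val f != 0) && ((val f)^-1 \in is_laurent).

Definition laurent_inv (f : laurent) : laurent := insubd f (val f)^-1.

Lemma laurent_mulVr : {in laurent_unit, left_inverse 1 laurent_inv *%R}.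
Proof.
move=> f /andP[f0 fV]; apply: val_inj.
by rewrite rmorphM rmorph1 /= val_insubd fV mulVf.
Qed.

Lemma laurent_unitPl (f g : laurent) : g * f = 1 -> f \in laurent_unit.
Proof.
move=> gf1; have vgf1 : val g * val f = 1 by rewrite -rmorphM gf1 rmorph1.
have f0 : val f != 0.
  by apply/eqP => f0; move/eqP: vgf1; rewrite f0 mulr0 eq_sym oner_eq0.
apply/andP; split=> //.
have -> : (val f)^-1 = val g by rewrite -[LHS]mul1r -vgf1 mulfK.
exact: laurentP.
Qed.

Lemma laurent_inv_out : {in [predC laurent_unit], laurent_inv =1 id}.
Proof.
move=> f; rewrite !inE /= /laurent_unit unfold_in negb_and negbK.
move=> /orP[/eqP f0 | fV]; apply: val_inj; rewrite /laurent_inv val_insubd.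
  by rewrite f0 invr0 if_same.
by rewrite (negbTE fV).
Qed.

HB.instance Definition _ := GRing.ComNzRing_hasMulInverse.Build laurent
  laurent_mulVr laurent_unitPl laurent_inv_out.

Lemma laurentX_subproof : tofrac 'X \in is_laurent.
Proof. by apply/asboolP; exists 'X, 0%N; rewrite expr0 divr1. Qed.

Definition A : laurent := Laurent laurentX_subproof.

Lemma A_unit : A \is a GRing.unit.
Proof.
apply/andP; split; first exact: tofracX_neq0.
by apply/asboolP; exists 1, 1%N; rewrite tofrac1 expr1 mul1r.
Qed.

Definition delta : laurent := - A ^+ 2 - A ^- 2.

(* The pair (a, b) stands for a[oo] + b[0]. *)
Definition laurent2 : Type := (laurent * laurent)%type.

Definition v (u : laurent2) : laurent := u.1 * delta + u.2.

Record fraction : Type := Fraction {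
  num_den :> nat * nat;
  fractionP : coprime num_den.1 num_den.2 }.

HB.instance Definition _ := [isSub for num_den].
HB.instance Definition _ := [Equality of fraction by <:].

Definition num (x : fraction) : nat := (val x).1.
Definition den (x : fraction) : nat := (val x).2.

Definition frac0 : fraction := @Fraction (0, 1)%N isT.
Definition frac1 : fraction := @Fraction (1, 1)%N isT.
Definition fracoo : fraction := @Fraction (1, 0)%N isT.

Definition frac_lt (x y : fraction) : bool :=
  (num x * den y < num y * den x)%N.

(* qr - ps = 1, where x = p/q and y = r/s; this forces x < y. *)
Definition farey_neighbors (x y : fraction) : bool :=
  (den x * num y == num x * den y + 1)%N.

(* For Farey neighbors (p+r)/(q+s) is already irreducible; the default value
   x is only reached on other pairs (insub_eq is insub, made to compute). *)
Definition farey_sum (x y : fraction) : fraction :=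
  odflt x (insub_eq fraction (num x + num y, den x + den y)%N).

Inductive letter : Type := L | R.

Definition word : Type := seq letter.

(* The vertex reached by following the letters of s downwards, starting from
   the vertex with parents (y, z). *)
Fixpoint descend (s : word) (y z : fraction) : fraction :=
  match s with
  | [::] => farey_sum y z
  | L :: s' => descend s' y (farey_sum y z)
  | R :: s' => descend s' (farey_sum y z) z
  end.

(* The rational number corresponding to w, i.e. the inverse image of w under
   alpha |-> w(alpha): the last letter of w is the first step below 1/2. *)
Definition fraction_of_word (w : word) : fraction :=
  descend (rev w) frac0 frac1.

(* Only meant for words of Farey neighbors, whose lengths always differ. *)
Definition vee (w w' : word) : word :=
  if (size w < size w')%N then L :: w' else R :: w.

(* A fundamental triangle is given by its upper edge (y_i, z_i). *)
Definition triangle : Type := (fraction * fraction)%type.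

Definition bottom (t : triangle) : fraction := farey_sum t.1 t.2.

Fixpoint triangles_from (n : nat) (x y z : fraction) : seq triangle :=
  if n is n'.+1 then
    let m := farey_sum y z in
    (y, z) :: (if m == x then [::]
               else if frac_lt m x then triangles_from n' x m z
               else triangles_from n' x y m)
  else [::].

(* The bound num x + den x is never exhausted when 0 < x < oo: the sum of the
   numerator and denominator of m_i starts at 2, strictly increases with i, and
   is num x + den x for m_N = x. *)
Definition ancestor_triangle (x : fraction) : seq triangle :=
  triangles_from (num x + den x) x frac0 fracoo.

(* Each oblique side is a chain ending with an edge into x, so it has as many
   edges as there are distinct y_i's (resp. z_i's). *)
Definition left_edges (x : fraction) : nat :=
  size (undup [seq t.1 | t <- ancestor_triangle x]).
Definition right_edges (x : fraction) : nat :=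
  size (undup [seq t.2 | t <- ancestor_triangle x]).

Definition parent_in (T : seq triangle) : rel fraction :=
  fun u u' => has (fun t => (u' == bottom t) && ((u == t.1) || (u == t.2))) T.

Fixpoint subseqs (X : Type) (s : seq X) : seq (seq X) :=
  if s is a :: s' then [seq a :: g | g <- subseqs s'] ++ subseqs s'
  else [:: [::]].

(* A path is the sequence of its vertices, the starting point c included.
   After c, a descending path visits vertices m_i with increasing i, so the
   paths can be listed by filtering the subsequences of m_1, ..., m_N. *)
Definition descending_paths (c x : fraction) : seq (seq fraction) :=
  let T := ancestor_triangle x in
  [seq c :: g | g <- subseqs [seq bottom t | t <- T]
              & path (parent_in T) c g && (last c g == x)].

(* Every descending path from 0 or oo to x meets {y_i, z_i}; the last of its
   vertices in this set is where it leaves the upper edge of the i-th triangle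
   for a vertex m_j with j >= i.  The triangle is on the left of the path when
   this happens at the right corner z_i, on the right when it happens at the
   left corner y_i. *)
Definition exit_corner (g : seq fraction) (t : triangle) : fraction :=
  last t.1 [seq u <- g | (u == t.1) || (u == t.2)].

Definition w_left (x : fraction) (g : seq fraction) : nat :=
  count (fun t => exit_corner g t == t.2) (ancestor_triangle x).
Definition w_right (x : fraction) (g : seq fraction) : nat :=
  count (fun t => exit_corner g t == t.1) (ancestor_triangle x).

Definition phi_oo (x : fraction) : laurent :=
  A ^+ 6 * (- A ^+ 4) ^- right_edges x
    * \sum_(g <- descending_paths fracoo x) (- A ^+ 4) ^+ w_right x g.

Definition phi_0 (x : fraction) : laurent :=
  (- A ^+ 4) ^+ left_edges x
    * \sum_(g <- descending_paths frac0 x) (- A ^+ 4) ^- w_left x g.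

Definition phi (x : fraction) : laurent2 :=
  if x == fracoo then (A ^+ 6, 0)
  else if x == frac0 then (0, 1)
  else (phi_oo x, phi_0 x).

(* The bracket of the zigzag-type frieze Gamma(w), computed with the word w;
   the frieze enters only through w. *)
Definition frieze_bracket (w : word) : laurent := v (phi (fraction_of_word w)).

(* Main.v *)
Require Import Defs.
From mathcomp Require Import all_boot all_order all_algebra.
From mathcomp Require Import zify ring.

(** Put q = - A^4. Everything follows from one recursion, valid for every pair
    of Farey neighbors y < z, including those with y = 0 or z = oo:
      phi (y # z) = q phi (y) + q^-1 phi (z).
    A descending path to y # z arrives through y or through z, which splits both
    path sums in two; the point is that the weights of these paths, corrected by
    the lengths of the oblique sides, differ from the weights defining phi (y)
    and phi (z) by exactly q and q^-1.

    To compare weights taken in different ancestor triangles, the triangles are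
    piled up one by one. A word s read from the top edge (0, oo) leads to an edge
    [edge s root] = (y, z), hanging below a pile [strip s root]; the ancestor
    triangle of y # z is this pile followed by the triangle on (y, z)
    ([ancestor_triangle_edge]). A path sum makes sense for a pile and any
    vertex, and adding a triangle changes the sums at y and z by a monomial and
    creates the sum at y # z ([path_sum_corner], [path_sum_bottom]). Induction on
    s then shows that the path sums of the pile at y and z, multiplied by the
    power of q given by its oblique sides, stay equal to the coordinates of
    phi (y) and phi (z), up to fixed units ([phi_corners]). The recursion is the
    next step of this induction (stated after applying v in [v_phi_farey_sum]);
    it applies to every pair of neighbors, because subtracting
    coordinatewise one of two Farey neighbors from the other, which has the
    larger coordinates, shows that they form an edge ([farey_edge_reached]).

    It remains to translate words into edges. The bracket of w is obtained from
    the two parents of its fraction, so each formula of the theorem states which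
    fractions these parents are; the three initial values come from
    v (phi (0)) = v (phi (1)) = 1. For Farey neighbors coming from words w and
    w', the last letter of the word leading to the edge says which of the two is
    the bottom of the preceding triangle; the other one is an older vertex, hence
    has a shorter word ([edge_vertex]), and this is the case distinction in the
    definition of [vee] ([upper_edge_vee]). *)

Set Implicit Arguments.
Unset Strict Implicit.
Unset Printing Implicit Defensive.

Import GRing.Theory.

Local Open Scope ring_scope.

(** * Farey sums *)

(** A size that is positive and additive under Farey sums: it measures progress
    down the tree and separates new vertices from old ones. *)
Definition height (x : fraction) : nat := (num x + den x)%N.

Definition farey_edge (t : triangle) : bool := farey_neighbors t.1 t.2.

Lemma fraction_inj (x y : fraction) : num x = num y -> den x = den y -> x = y.
Proof.
move=> nxy dxy; apply: val_inj; move: nxy dxy; rewrite /num /den.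
by case: (val x) (val y) => [a b] [c d] /= -> ->.
Qed.

Lemma height_gt0 x : (0 < height x)%N.
Proof.
rewrite /height /num /den; case: x => [[[|a] [|b]] /= co] //.
Qed.

Lemma farey_coprime (a b c d : nat) : (b * c = a * d + 1)%N -> coprime a b.
Proof.
move=> e; rewrite /coprime -dvdn1 -(dvdn_addr (m := a * d)%N).
  by rewrite -e dvdn_mulr // dvdn_gcdr.
by rewrite dvdn_mulr // dvdn_gcdl.
Qed.

(** The coordinates of the sum satisfy a Bezout identity with those of [t.2], so
    they are coprime and the Farey sum takes its intended value. *)
Lemma farey_sum_coord t : farey_edge t ->
  num (bottom t) = (num t.1 + num t.2)%N /\
  den (bottom t) = (den t.1 + den t.2)%N.
Proof.
move=> /eqP e; rewrite /bottom /farey_sum insub_eqE.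
have co : coprime (num t.1 + num t.2) (den t.1 + den t.2).
  by apply: (@farey_coprime _ _ (num t.2) (den t.2)); lia.
by rewrite (@insubT _ (fun p => coprime p.1 p.2) fraction (_, _) co).
Qed.

Lemma height_bottom t : farey_edge t ->
  height (bottom t) = (height t.1 + height t.2)%N.
Proof. by move=> /farey_sum_coord[]; rewrite /height => -> ->; lia. Qed.

(** * Edges and strips *)

Definition step (t : triangle) (a : letter) : triangle :=
  match a with L => (t.1, bottom t) | R => (bottom t, t.2) end.

Definition edge (s : word) (t : triangle) : triangle := foldl step t s.

Fixpoint strip (s : word) (t : triangle) : seq triangle :=
  if s is a :: s' then t :: strip s' (step t a) else [::].

Definition root : triangle := (frac0, fracoo).

Lemma edge_rcons s a t : edge (rcons s a) t = step (edge s t) a.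
Proof. by rewrite /edge -cats1 foldl_cat. Qed.

Lemma strip_rcons s a t : strip (rcons s a) t = rcons (strip s t) (edge s t).
Proof. by elim: s t => //= b s IH t; rewrite IH. Qed.

Lemma descendE s t : descend s t.1 t.2 = bottom (edge s t).
Proof. by elim: s t => //= a s IH [y z]; rewrite -IH; case: a. Qed.

Lemma step_farey t a : farey_edge t -> farey_edge (step t a).
Proof.
move=> Ft; have [n d] := farey_sum_coord Ft; move/eqP: Ft => e.
by apply/eqP; case: a; rewrite /= n d; lia.
Qed.

Lemma edge_farey s t : farey_edge t -> farey_edge (edge s t).
Proof. by elim: s t => //= a s IH t /(step_farey a)/IH. Qed.

Lemma height_edge s t : farey_edge t ->
  (size s + height (bottom t) <= height (bottom (edge s t)))%N.
Proof.
elim: s t => //= a s IH t Ft; have Fs := step_farey a Ft.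
apply: leq_trans (IH _ Fs); rewrite (height_bottom Fs) (height_bottom Ft).
have := height_gt0 t.1; have := height_gt0 t.2.
by case: a {Fs} => /=; rewrite (height_bottom Ft); lia.
Qed.

(** Each step replaces an end of the edge by the sum of both ends, so descending
    only ever takes positive combinations of the initial ends. *)
Lemma edge_combination s t : farey_edge t ->
  exists a b : nat, [/\ (0 < a)%N, (0 < b)%N,
    num (bottom (edge s t)) = (a * num t.1 + b * num t.2)%N &
    den (bottom (edge s t)) = (a * den t.1 + b * den t.2)%N].
Proof.
elim: s t => [|c s IH] t Ft.
  by have [n d] := farey_sum_coord Ft; exists 1%N, 1%N; rewrite !mul1n.
have [n d] := farey_sum_coord Ft.
have [a [b [a0 b0]]] := IH _ (step_farey c Ft).
case: c => /= -> ->; rewrite n d.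
  by exists (a + b)%N, b; split; lia.
by exists a, (a + b)%N; split; lia.
Qed.

Lemma frac_ltxx x : frac_lt x x = false.
Proof. by rewrite /frac_lt ltnn. Qed.

Lemma frac_lt_asym x y : frac_lt x y -> frac_lt y x = false.
Proof. by rewrite /frac_lt; lia. Qed.

Lemma edge_between s t : farey_edge t ->
  frac_lt t.1 (bottom (edge s t)) /\ frac_lt (bottom (edge s t)) t.2.
Proof.
move=> Ft; have [a [b [a0 b0 n d]]] := edge_combination s Ft.
by move/eqP: Ft => e; rewrite /frac_lt n d; split; nia.
Qed.

Lemma edge_left s t : farey_edge t ->
  frac_lt (bottom (edge (L :: s) t)) (bottom t).
Proof. by move=> /(step_farey L)/(edge_between s)[]. Qed.

Lemma edge_right s t : farey_edge t ->
  frac_lt (bottom t) (bottom (edge (R :: s) t)).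
Proof. by move=> /(step_farey R)/(edge_between s)[]. Qed.

(** The first letter is determined by comparing the fraction with the first
    bottom: everything in the left subtree is smaller, everything in the right
    subtree is larger. *)
Lemma bottom_edge_inj t : farey_edge t ->
  injective (fun s => bottom (edge s t)).
Proof.
move=> Ft s s'; elim: s s' t Ft => [|a s IH] [|a' s'] t Ft //= e.
- case: a' e => e.
    by have := edge_left s' Ft; rewrite /= -e frac_ltxx.
  by have := edge_right s' Ft; rewrite /= -e frac_ltxx.
- case: a e => e.
    by have := edge_left s Ft; rewrite /= e frac_ltxx.
  by have := edge_right s Ft; rewrite /= e frac_ltxx.
have aa' : a = a'.
  case: a a' e => -[] //= e.
    by have := edge_right s' Ft; rewrite /= -e (frac_lt_asym (edge_left s Ft)).
  by have := edge_left s' Ft; rewrite /= -e (frac_lt_asym (edge_right s Ft)).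
by rewrite -aa' in e *; rewrite (IH _ _ (step_farey a Ft) e).
Qed.

(** The search compares the fraction with the bottoms met on the way to it, so
    it takes the steps prescribed by s. *)
Lemma triangles_from_edge n s t : farey_edge t -> (size s < n)%N ->
  triangles_from n (bottom (edge s t)) t.1 t.2 = rcons (strip s t) (edge s t).
Proof.
elim: n s t => //= n IH [|a s] [y z] Ft sn.
  by rewrite eqxx.
rewrite -/(bottom (y, z)).
have Fa := step_farey a Ft.
have {IH} := IH s _ Fa sn; case: a Fa {sn} => /= Fa <-.
  have lt := edge_left s Ft; rewrite (frac_lt_asym lt).
  by case: eqP => // e; move: lt; rewrite -{1}e /= frac_ltxx.
have lt := edge_right s Ft; rewrite lt.
by case: eqP => // e; move: lt; rewrite -{1}e /= frac_ltxx.
Qed.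

Lemma farey_root : farey_edge root.
Proof. by []. Qed.

Lemma ancestor_triangle_edge s :
  ancestor_triangle (bottom (edge s root))
  = rcons (strip s root) (edge s root).
Proof.
apply: (triangles_from_edge farey_root).
apply: leq_trans (height_edge s farey_root).
by rewrite (height_bottom farey_root) addn2.
Qed.

(** Descent on the heights: the fraction with the larger coordinates has the
    other one as a parent, and is replaced by its second parent. If neither
    dominates the other, the Farey equation forces the pair (0, oo). *)
Lemma farey_edge_reached t : farey_edge t -> exists s, edge s root = t.
Proof.
have [n] := ubnP (height t.1 + height t.2).
elim: n t => // n IH [y z] /=; rewrite ltnS => hn Fyz.
have e := eqP Fyz; rewrite /= in e.
have hy := height_gt0 y; have hz := height_gt0 z.
have [/andP[p q]|nL] := boolP ((num y <= num z) && (den y <= den z))%N.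
  have e' : (den y * (num z - num y) = num y * (den z - den y) + 1)%N.
    by rewrite !mulnBr e; have := leq_mul (leqnn (num y)) q; lia.
  have co : coprime (num z - num y) (den z - den y).
    by rewrite coprime_sym; apply: (@farey_coprime _ _ (den y) (num y)); lia.
  pose z' := @Fraction (_, _) co.
  have nE : num z' = (num z - num y)%N by [].
  have dE : den z' = (den z - den y)%N by [].
  have Ft : farey_edge (y, z') by apply/eqP.
  have [|s es] := IH (y, z') _ Ft.
    apply: leq_trans hn; move: hy hz; rewrite /height /= nE dE; lia.
  exists (rcons s L); rewrite edge_rcons es /=; congr (_, _).
  have [nB dB] := farey_sum_coord Ft.
  by apply: fraction_inj; rewrite ?nB ?dB /= ?nE ?dE; lia.
have [/andP[p q]|nR] := boolP ((num z <= num y) && (den z <= den y))%N.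
  have e' : ((den y - den z) * num z = (num y - num z) * den z + 1)%N.
    by rewrite !mulnBl e; have := leq_mul p (leqnn (den z)); lia.
  have co : coprime (num y - num z) (den y - den z).
    exact: farey_coprime e'.
  pose y' := @Fraction (_, _) co.
  have nE : num y' = (num y - num z)%N by [].
  have dE : den y' = (den y - den z)%N by [].
  have Ft : farey_edge (y', z) by apply/eqP.
  have [|s es] := IH (y', z) _ Ft.
    apply: leq_trans hn; move: hy hz; rewrite /height /= nE dE; lia.
  exists (rcons s R); rewrite edge_rcons es /=; congr (_, _).
  have [nB dB] := farey_sum_coord Ft.
  by apply: fraction_inj; rewrite ?nB ?dB /= ?nE ?dE; lia.
have [dy nz ny dz] : [/\ den y = 1, num z = 1, num y = 0 & den z = 0]%N.
  by split; nia.
by exists [::]; congr (_, _); apply: fraction_inj; rewrite ?dy ?nz ?ny ?dz.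
Qed.

(** Only 0 and oo have height 1, and each end of an edge is one of these or the
    bottom of an earlier triangle. *)
Lemma edge_vertex s u : u \in [:: (edge s root).1; (edge s root).2] ->
  height u = 1%N \/ exists2 s', (size s' < size s)%N & bottom (edge s' root) = u.
Proof.
elim/last_ind: s u => [|s a IH] u.
  by rewrite !inE => /orP[]/eqP->; left.
rewrite edge_rcons size_rcons.
have old : u \in [:: (edge s root).1; (edge s root).2] ->
  height u = 1%N \/
    exists2 s', (size s' < (size s).+1)%N & bottom (edge s' root) = u.
  by move=> /IH[|[s' ss' e]]; [left | right; exists s'; rewrite // ltnW].
have new : u = bottom (edge s root) -> height u = 1%N \/
    exists2 s', (size s' < (size s).+1)%N & bottom (edge s' root) = u.
  by move=> ->; right; exists s.
by case: a; rewrite !inE => /orP[]/eqP // e; apply: old; rewrite !inE e eqxx ?orbT.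
Qed.

(** * Path sums *)

Section PathSums.

Variables (K : nzRingType) (a : K) (side : triangle -> fraction).

(** When T is the ancestor triangle of x, c is 0 or oo, [side] is a projection
    and a is - A^4 or its inverse, these are the sums in the definition of phi.
    Allowing a vertex x that is not the bottom of T lets a sum be followed while
    triangles are added below x: those triangles count on the side determined by
    the corner where the path ends. *)
Definition path_sum (T : seq triangle) (c x : fraction) : K :=
  \sum_(g <- subseqs [seq bottom t | t <- T]
          | path (parent_in T) c g && (last c g == x))
    a ^+ count (fun t => exit_corner (c :: g) t == side t) T.

Lemma big_subseqs_rcons (X : Type) (F : seq X -> K) B m :
  \sum_(g <- subseqs (rcons B m)) F g
  = \sum_(g <- subseqs B) (F g + F (rcons g m)).
Proof.
elim: B F => [|b B IH] F /=; first by rewrite !(big_cons, big_nil) !addr0 addrC.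
by rewrite !big_cat !big_map /= !IH.
Qed.

Lemma mem_subseqs (X : eqType) (g B : seq X) :
  g \in subseqs B -> {subset g <= B}.
Proof.
elim: B g => [|b B IH] g /=; first by rewrite inE => /eqP->.
rewrite mem_cat => /orP[/mapP[g' /IH sg' ->]|/IH sg] u.
  by rewrite !inE => /orP[->//|/sg' ->]; rewrite orbT.
by move=> /sg; rewrite inE orbC => ->.
Qed.

(** The bottom of an added triangle must not occur above it, so that it changes
    neither the older paths nor their exit corners. *)
Definition fresh (m : fraction) (T : seq triangle) : bool :=
  all (fun t => m \notin [:: t.1; t.2; bottom t]) T.

Lemma parent_in_rcons T t u w : parent_in (rcons T t) u w =
  parent_in T u w || (w == bottom t) && ((u == t.1) || (u == t.2)).
Proof. by rewrite /parent_in has_rcons orbC. Qed.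

Lemma parent_in_fresh T m u : fresh m T -> parent_in T u m = false.
Proof.
move=> /allP fr; apply/hasP => -[t /fr]; rewrite !inE !negb_or.
by move=> /and3P[_ _ /negbTE->].
Qed.

Lemma exit_corner_last g x t : x \in [:: t.1; t.2] -> last t.1 g = x ->
  exit_corner g t = x.
Proof.
rewrite !inE /exit_corner; case/lastP: g => [|g u] xt; first by [].
by rewrite last_rcons => ux; rewrite filter_rcons ux xt last_rcons.
Qed.

Lemma exit_corner_rcons g m t : m \notin [:: t.1; t.2] ->
  exit_corner (rcons g m) t = exit_corner g t.
Proof. by rewrite !inE /exit_corner filter_rcons => /negbTE->. Qed.

Section AddTriangle.

Variables (T : seq triangle) (t : triangle) (c : fraction).

Hypothesis fresh_bottom : fresh (bottom t) T.
Hypothesis bottom_corner : bottom t \notin [:: t.1; t.2].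
Hypothesis bottom_start : c != bottom t.

Let B := [seq bottom t' | t' <- T].

Lemma bottom_notin g : g \in subseqs B -> bottom t \notin c :: g.
Proof.
move=> /mem_subseqs sg; rewrite inE eq_sym (negbTE bottom_start) /=.
apply/negP => /sg/mapP[t' /(allP fresh_bottom)].
by rewrite !inE => /norP[_ /norP[_ /negP]] nm /eqP.
Qed.

Lemma path_add g : bottom t \notin g ->
  path (parent_in (rcons T t)) c g = path (parent_in T) c g.
Proof.
move=> ng; apply: (@eq_in_path _ (predC1 (bottom t))) => //=; last first.
  by rewrite bottom_start; apply/allP => u ug /=; apply: contraNneq ng => <-.
by move=> u w _ /negbTE nw; rewrite parent_in_rcons nw /= orbF.
Qed.

(** No path to x passes through the new bottom, and each of them leaves the new
    edge at x itself. *)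
Lemma path_sum_corner x : x \in [:: t.1; t.2] ->
  path_sum (rcons T t) c x = a ^+ (x == side t) * path_sum T c x.
Proof.
move=> xt; have nx : bottom t != x by apply: contraNneq bottom_corner => ->.
rewrite /path_sum map_rcons big_mkcond big_subseqs_rcons mulr_sumr.
rewrite [RHS]big_mkcond; apply: eq_big_seq => g gB.
have := bottom_notin gB; rewrite inE => /norP[_ ng].
rewrite last_rcons (negbTE nx) andbF addr0 path_add //.
case: andP => // -[_ /eqP gx].
rewrite -cats1 count_cat /= addn0 addnC exprD.
by rewrite (exit_corner_last (x := x)).
Qed.

(** A path to the new bottom is a path to one of the corners followed by a last
    step; it leaves the new edge at that corner. *)
Lemma path_sum_bottom : t.1 != t.2 ->
  path_sum (rcons T t) c (bottom t)
  = a ^+ (t.1 == side t) * path_sum T c t.1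
    + a ^+ (t.2 == side t) * path_sum T c t.2.
Proof.
move=> t12; rewrite /path_sum map_rcons big_mkcond big_subseqs_rcons.
rewrite !mulr_sumr [X in _ = X + _]big_mkcond [X in _ = _ + X]big_mkcond.
rewrite -big_split.
apply: eq_big_seq => g gB /=.
have ncg := bottom_notin gB; have /norP[_ ng] := ncg.
have -> : last c g == bottom t = false.
  by apply: contraNF ncg => /eqP <-; rewrite mem_last.
rewrite andbF add0r last_rcons eqxx andbT rcons_path path_add //.
rewrite parent_in_rcons parent_in_fresh // eqxx /=.
case: (path _ c g) => //=; last by rewrite addr0.
have cnt : count (fun t' => exit_corner (c :: rcons g (bottom t)) t' == side t') T
           = count (fun t' => exit_corner (c :: g) t' == side t') T.
  apply: eq_in_count => t' /(allP fresh_bottom) nt'.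
  rewrite -rcons_cons exit_corner_rcons //.
  by apply: contraNN nt'; rewrite !inE => /orP[]->; rewrite ?orbT.
have key x : x \in [:: t.1; t.2] -> last c g = x ->
    count (fun t' => exit_corner (c :: rcons g (bottom t)) t' == side t')
      (rcons T t)
    = ((x == side t) + count (fun t' => exit_corner (c :: g) t' == side t') T)%N.
  move=> xt gx; rewrite -[rcons T t]cats1 count_cat cnt /= addn0 addnC -rcons_cons.
  by rewrite exit_corner_rcons // (exit_corner_last xt).
(* Each g ends at one corner, at the other, or contributes nothing. *)
have [g1|g1] := eqVneq (last c g) t.1.
  by rewrite g1 (negbTE t12) addr0 (key t.1) ?exprD // inE eqxx.
have [g2|g2] := eqVneq (last c g) t.2; last by rewrite addr0.
by rewrite add0r (key t.2) ?exprD // !inE eqxx orbT.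
Qed.

End AddTriangle.

End PathSums.

Lemma strip_height s t : t \in strip s root ->
  forall u, u \in [:: t.1; t.2; bottom t] ->
  (height u < height (bottom (edge s root)))%N.
Proof.
elim/last_ind: s t => [//|s a IH] t; rewrite strip_rcons edge_rcons.
have F := edge_farey s farey_root; have Fa := step_farey a F.
have h := height_edge [:: a] F; rewrite /= add1n in h.
rewrite mem_rcons inE => /orP[/eqP-> u|/IH{}IH u /IH ult]; last first.
  exact: ltn_trans ult h.
move=> ut; apply: leq_ltn_trans h; move: ut; rewrite !inE height_bottom //.
by move=> /or3P[]/eqP->; rewrite ?height_bottom // ?leq_addr ?leq_addl.
Qed.

Lemma strip_fresh s : fresh (bottom (edge s root)) (strip s root).
Proof.
apply/allP => t ts; apply/negP => /(strip_height ts).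
by rewrite ltnn.
Qed.

Lemma bottom_notin_edge t : farey_edge t -> bottom t \notin [:: t.1; t.2].
Proof.
move=> /height_bottom h; apply/negP; rewrite !inE.
have := height_gt0 t.1; have := height_gt0 t.2.
by move=> h1 h2 /orP[]/eqP e; rewrite e in h; lia.
Qed.

Lemma height_edge_gt1 s : (1 < height (bottom (edge s root)))%N.
Proof.
rewrite height_bottom ?edge_farey //.
by have := height_gt0 (edge s root).1; have := height_gt0 (edge s root).2; lia.
Qed.

Lemma farey_edge_neq t : farey_edge t -> t.1 != t.2.
Proof. by move=> /eqP e; apply/eqP => e12; rewrite e12 in e; lia. Qed.

Lemma size_undup_rcons (X : eqType) (s : seq X) x :
  size (undup (rcons s x)) = (size (undup s) + (x \notin s))%N.
Proof.
have /perm_undup/perm_size -> : rcons s x =i x :: s by exact: mem_rcons.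
by rewrite /=; case: (x \in s); rewrite ?addn0 ?addn1.
Qed.

(** * The Farey recursion *)

Local Notation q := (- A ^+ 4).

Lemma q_unit : q \is a GRing.unit.
Proof. by rewrite unitrN unitrX // A_unit. Qed.

(** A triangle is on the left of a path when the path leaves its upper edge at
    the right corner, hence [snd] for the weight w_L and [fst] for w_R. *)
Definition left_sum := path_sum q^-1 snd.
Definition right_sum := path_sum q fst.

Lemma phi_bottom s (T := ancestor_triangle (bottom (edge s root))) :
  phi (bottom (edge s root)) =
  (A ^+ 6 * q ^- size (undup [seq t.2 | t <- T])
     * right_sum T fracoo (bottom (edge s root)),
   q ^+ size (undup [seq t.1 | t <- T])
     * left_sum T frac0 (bottom (edge s root))).
Proof.
have h := height_edge_gt1 s; rewrite /phi.
case: eqP => [e|_]; first by rewrite e in h.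
case: eqP => [e|_]; first by rewrite e in h.
congr (_, _); rewrite /phi_oo /phi_0 /descending_paths big_map big_filter //.
by congr (_ * _); apply: eq_bigr => g _; rewrite exprVn.
Qed.

Lemma strip_step s (t := edge s root) :
  [/\ right_sum (rcons (strip s root) t) fracoo t.1
      = q * right_sum (strip s root) fracoo t.1,
      right_sum (rcons (strip s root) t) fracoo t.2
      = right_sum (strip s root) fracoo t.2 &
      right_sum (rcons (strip s root) t) fracoo (bottom t)
      = q * right_sum (strip s root) fracoo t.1
        + right_sum (strip s root) fracoo t.2] /\
  [/\ left_sum (rcons (strip s root) t) frac0 t.1
      = left_sum (strip s root) frac0 t.1,
      left_sum (rcons (strip s root) t) frac0 t.2
      = q^-1 * left_sum (strip s root) frac0 t.2 &
      left_sum (rcons (strip s root) t) frac0 (bottom t)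
      = left_sum (strip s root) frac0 t.1
        + q^-1 * left_sum (strip s root) frac0 t.2].
Proof.
have Ft : farey_edge t by apply: edge_farey.
have fr := strip_fresh s; have nt := bottom_notin_edge Ft.
have t12 := farey_edge_neq Ft; have t21 : t.2 != t.1 by rewrite eq_sym.
have h := height_edge_gt1 s; rewrite -/t in fr h.
have start c : height c = 1%N -> c != bottom t.
  by move=> hc; apply/eqP => e; rewrite -e hc in h.
have m1 : t.1 \in [:: t.1; t.2] by rewrite inE eqxx.
have m2 : t.2 \in [:: t.1; t.2] by rewrite !inE eqxx orbT.
have boo := start fracoo erefl; have b0 := start frac0 erefl.
rewrite /right_sum /left_sum.
split; split.
all: first [ rewrite (path_sum_bottom _ _ fr nt) //
           | rewrite (path_sum_corner _ _ fr nt) // ].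
all: by rewrite ?eqxx ?(negbTE t12) ?(negbTE t21) ?expr1 ?expr0 ?mul1r.
Qed.

(** The lengths l and r of the oblique sides of the ancestor triangle of the
    bottom of [edge s root]. *)
Definition left_count s :=
  size (undup [seq t.1 | t <- rcons (strip s root) (edge s root)]).
Definition right_count s :=
  size (undup [seq t.2 | t <- rcons (strip s root) (edge s root)]).

(** A step to the left makes the new bottom a right corner, which lengthens the
    right oblique side and leaves the left one unchanged; symmetrically for a
    step to the right. *)
Lemma count_step s a :
  left_count (rcons s a) = (left_count s + if a is R then 1 else 0)%N /\
  right_count (rcons s a) = (right_count s + if a is L then 1 else 0)%N.
Proof.
have Ft : farey_edge (edge s root) by apply: edge_farey.
rewrite /left_count /right_count !strip_rcons edge_rcons.
set T := rcons (strip s root) _.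
have size_add (f : triangle -> fraction) t :
    size (undup [seq f t' | t' <- rcons T t])
    = (size (undup [seq f t' | t' <- T]) + (f t \notin [seq f t' | t' <- T]))%N.
  by rewrite map_rcons size_undup_rcons.
have tT : edge s root \in T by rewrite mem_rcons inE eqxx.
have fr1 : bottom (edge s root) \notin [seq t.1 | t <- T].
  apply/mapP => -[t]; rewrite mem_rcons inE => /orP[/eqP->|ts] e.
    by have := bottom_notin_edge Ft; rewrite {1}e inE eqxx.
  by have := allP (strip_fresh s) t ts; rewrite {1}e inE eqxx.
have fr2 : bottom (edge s root) \notin [seq t.2 | t <- T].
  apply/mapP => -[t]; rewrite mem_rcons inE => /orP[/eqP->|ts] e.
    by have := bottom_notin_edge Ft; rewrite {1}e !inE eqxx orbT.
  by have := allP (strip_fresh s) t ts; rewrite {1}e !inE eqxx orbT.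
by rewrite !size_add; case: a; rewrite /= ?fr1 ?fr2 ?(map_f _ tT).
Qed.

(** The invariant of the descent. The factors q^-1 at the right corner for oo
    and q at the left corner for 0 appear because the side lengths already
    include the edge from that corner to the next bottom. At a step, the new
    corner has the value of phi given by [phi_bottom]; for the old corner, the
    factor gained by the path sum ([path_sum_corner]) compensates the lengthening
    of a side ([count_step]), or neither changes. *)
Lemma phi_corners s (T := strip s root) (t := edge s root) :
  [/\ (phi t.1).1 = A ^+ 6 * q ^- right_count s * right_sum T fracoo t.1,
      q^-1 * (phi t.2).1
      = A ^+ 6 * q ^- right_count s * right_sum T fracoo t.2,
      q * (phi t.1).2 = q ^+ left_count s * left_sum T frac0 t.1 &
      (phi t.2).2 = q ^+ left_count s * left_sum T frac0 t.2].
Proof.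
have qK := mulVr q_unit.
have qS n : q ^+ n.+1 = q * q ^+ n := exprS q n.
have qSV n : q ^- n.+1 = q^-1 * q ^- n.
  by rewrite exprSr invrM ?unitrX ?q_unit.
rewrite {}/T {}/t; elim/last_ind: s => [|s a].
  rewrite /right_sum /left_sum /path_sum /= !big_cons !big_nil /=.
  by rewrite !addr0 ?mulr0 ?mulr1 expr1 mulrC.
set t := edge s root; set T := strip s root => -[oo1 oo2 z1 z2].
have := phi_bottom s; rewrite ancestor_triangle_edge -/t -/T.
rewrite -/(right_count s) -/(left_count s) => phm.
have [[s1 s2 s3] [s4 s5 s6]] := strip_step s.
rewrite -/t -/T in s1 s2 s3 s4 s5 s6.
have [-> ->] := count_step s a.
rewrite strip_rcons edge_rcons -/T -/t.
case: a => /=; rewrite ?addn0 ?addn1 ?phm /=; split.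
- by rewrite s1 oo1 qSV; ring: qK.
- by rewrite qSV; ring.
- by rewrite s4.
- by [].
- by [].
- by rewrite s2.
- by rewrite qS; ring.
- by rewrite s5 z2 qS; ring: qK.
Qed.

Lemma v_phi_farey_sum t : farey_edge t ->
  v (phi (bottom t)) = q * v (phi t.1) + q^-1 * v (phi t.2).
Proof.
move=> /farey_edge_reached[s <-].
have [oo1 oo2 z1 z2] := phi_corners s.
have [[_ _ s3] [_ _ s6]] := strip_step s.
rewrite phi_bottom ancestor_triangle_edge /v /=.
rewrite -/(right_count s) -/(left_count s) s3 s6 !mulrDr !mulrA z1 oo2 z2.
rewrite oo1; ring.
Qed.

(** * Words *)

(** The pair of parents of the fraction of w. The descent starts from the vertex
    1/2, whose parents (0, 1) are one left step away from (0, oo); hence the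
    first letter. *)
Definition upper_edge (w : word) : triangle := edge (L :: rev w) root.

Lemma bottom_root : bottom root = frac1.
Proof. by apply: fraction_inj. Qed.

Lemma fraction_of_wordE w : fraction_of_word w = bottom (upper_edge w).
Proof. by rewrite /fraction_of_word /upper_edge /= bottom_root -descendE. Qed.

Lemma upper_edge_cons a w : upper_edge (a :: w) = step (upper_edge w) a.
Proof. by rewrite /upper_edge rev_cons -rcons_cons edge_rcons. Qed.

Lemma frieze_bracket_corners w y z : upper_edge w = (y, z) ->
  frieze_bracket w = - A ^+ 4 * v (phi y) - A ^- 4 * v (phi z).
Proof.
rewrite /frieze_bracket fraction_of_wordE => e.
rewrite v_phi_farey_sum ?edge_farey // e.
by rewrite invrN (mulNr (A ^- 4)).
Qed.

(** Of two neighbors, the one farther down the tree is a child of the other, and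
    their sum is a child of it: the left child if it is the larger one, the right
    child otherwise. *)
Lemma upper_edge_vee w w' :
  farey_neighbors (fraction_of_word w) (fraction_of_word w') ->
  upper_edge (vee w w') = (fraction_of_word w, fraction_of_word w').
Proof.
move=> F; have [s es] := farey_edge_reached (F : farey_edge (_, _)).
have upperE s1 x : bottom (edge s1 root) = fraction_of_word x ->
    edge s1 root = upper_edge x.
  by rewrite fraction_of_wordE => /(bottom_edge_inj farey_root) ->.
(* A parent of the fraction of x' has a shorter word. *)
have older x x' : fraction_of_word x \in
    [:: (upper_edge x').1; (upper_edge x').2] -> (size x < size x')%N.
  move=> /edge_vertex[h|[s1 ss1]].
    by have := height_edge_gt1 (L :: rev x); rewrite -fraction_of_wordE h.
  rewrite fraction_of_wordE => /(bottom_edge_inj farey_root) e.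
  by move: ss1; rewrite e /= !size_rev.
(* The empty descent gives the pair (0, oo), but 0 has no word. *)
case/lastP: s es => [|s a].
  by move=> [e _]; have := height_edge_gt1 (L :: rev w); rewrite -fraction_of_wordE -e.
rewrite edge_rcons /vee; case: a => es; case: (es) => e1 e2.
  have sE := upperE _ _ e2; rewrite older; last by rewrite -sE -e1 inE eqxx.
  by rewrite upper_edge_cons -sE.
have sE := upperE _ _ e1; have lt : (size w' < size w)%N.
  by apply: older; rewrite -sE -e2 !inE eqxx orbT.
by rewrite ltnNge (ltnW lt) /= upper_edge_cons -sE.
Qed.

Lemma upper_edge_nseqR k w : (0 < k)%N ->
  upper_edge (nseq k R ++ L :: w)
  = (fraction_of_word (nseq k.-1 R ++ L :: w), fraction_of_word w).
Proof.
case: k => // k _; elim: k => [|k IH]; rewrite /= upper_edge_cons.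
  by rewrite upper_edge_cons /= !fraction_of_wordE upper_edge_cons.
by rewrite IH /= -!IH !fraction_of_wordE.
Qed.

Lemma upper_edge_nseqL k w : (0 < k)%N ->
  upper_edge (nseq k L ++ R :: w)
  = (fraction_of_word w, fraction_of_word (nseq k.-1 L ++ R :: w)).
Proof.
case: k => // k _; elim: k => [|k IH]; rewrite /= upper_edge_cons.
  by rewrite upper_edge_cons /= !fraction_of_wordE upper_edge_cons.
by rewrite IH /= -!IH !fraction_of_wordE.
Qed.

Theorem theorem3p14 :
  frieze_bracket [::] = - A ^+ 4 - A ^- 4
  /\ frieze_bracket [:: L] = - A ^+ 4 + 1 + A ^- 8
  /\ frieze_bracket [:: R] = A ^+ 8 + 1 - A ^- 4
  /\ (forall w w' : word,
        farey_neighbors (fraction_of_word w) (fraction_of_word w') ->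
        frieze_bracket (vee w w')
        = - A ^+ 4 * frieze_bracket w - A ^- 4 * frieze_bracket w')
  /\ (forall (k : nat) (w : word), (0 < k)%N ->
        frieze_bracket (nseq k R ++ L :: w)
        = - A ^+ 4 * frieze_bracket (nseq k.-1 R ++ L :: w)
          - A ^- 4 * frieze_bracket w)
  /\ (forall (k : nat) (w : word), (0 < k)%N ->
        frieze_bracket (nseq k L ++ R :: w)
        = - A ^+ 4 * frieze_bracket w
          - A ^- 4 * frieze_bracket (nseq k.-1 L ++ R :: w)).
Proof.
have AV : A ^+ 4 * A ^- 4 = 1 by rewrite mulrV // unitrX ?A_unit.
have AV8 : A ^- 8 = A ^- 4 * A ^- 4.
  by rewrite -invrM ?unitrX ?A_unit // -exprD.
have v0 : v (phi frac0) = 1 by rewrite /v /phi /= mul0r add0r.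
have voo : v (phi fracoo) = - A ^+ 8 - A ^+ 4.
  rewrite /v /phi /= addr0 /delta mulrDr !mulrN -exprD.
  by rewrite (exprD A 4 2) mulrK ?unitrX ?A_unit.
have v1 : v (phi frac1) = 1.
  rewrite -bottom_root v_phi_farey_sum // v0 voo invrN (exprD A 4 4).
  by ring: AV.
have e0 : upper_edge [::] = (frac0, frac1) by rewrite /upper_edge /= bottom_root.
have f0 : frieze_bracket [::] = - A ^+ 4 - A ^- 4.
  by rewrite (frieze_bracket_corners e0) v0 v1 !mulr1.
do ![split=> //].
- rewrite (@frieze_bracket_corners _ frac0 (fraction_of_word [::])).
    by rewrite -/(frieze_bracket _) f0 v0 AV8; ring: AV.
  by rewrite upper_edge_cons fraction_of_wordE e0.
- rewrite (@frieze_bracket_corners _ (fraction_of_word [::]) frac1).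
    by rewrite -/(frieze_bracket _) f0 v1 (exprD A 4 4); ring: AV.
  by rewrite upper_edge_cons fraction_of_wordE e0.
- by move=> w w' /upper_edge_vee/frieze_bracket_corners.
- by move=> k w /(upper_edge_nseqR w)/frieze_bracket_corners.
- by move=> k w /(upper_edge_nseqL w)/frieze_bracket_corners.
Qed.
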